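(* Let $n\ge2$, let $P$ be a positive regular polynomial $n$-tuple and let $m\in\mathbb N^n$. Assume that $\frac1{\mathscr K_{P,m}}$ is a hereditary polynomial. Then $\mathscr M_z^*=(\mathscr M_{z_1}^*,\ldots,\mathscr M_{z_n}^* )$ on $\mathscr H^2_m(\triangle^n_P)$ is a $\triangle^n_P$-contraction of order $m$.
   Context: $\mathbb N$ = positive integers, $\mathbb Z_+$ = nonnegative integers, $\mathbb C_*=\mathbb C\setminus\{0\}$, $z\diamond w=(z_1w_1,\ldots,z_nw_n)$, and $\overline z$ is the entrywise conjugate. For $n\ge2$ let $\varphi(z)=\big(\frac{z_1}{z_2},\ldots,\frac{z_{n-1}}{z_n},z_n\big)$ for $z\in\mathbb C\times\mathbb C_*^{n-1}$. A polynomial $n$-tuple $P=(P_1,\ldots,P_n)$ in $\mathbb C[z_1,\ldots,z_n]$ is positive regular if for each $j$, $P_j$ has nonnegative coefficients and $P_j(z)=a_jz_j+\sum_{k=2}^{N_j}Q_{jk}(z)$ with $a_j>0$ and $Q_{jk}$ homogeneous of degree $k$. The $P$-triangle is $\triangle^n_P=\{z\in\mathbb C\times\mathbb C_*^{n-1}: P_j(\varphi(z)\diamond\overline{\varphi(z)})<1,\ j=1,\ldots,n\}$. For $m\in\mathbb N^n$, $\mathscr H^2_m(\triangle^n_P)$ is the reproducing kernel Hilbert space of holomorphic functions on $\triangle^n_P$ with kernel $$\mathscr K_{P,m}(z,w)=\prod_{j=2}^n\frac1{z_j\overline w_j}\prod_{j=1}^n\frac1{\big(1-P_j(\varphi(z)\diamond\overline{\varphi(w)})\big)^{m_j}}.$$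 Each $z_j$ is a multiplier of this space; $\mathscr M_{z_j}$ is the bounded operator of multiplication by $z_j$. ''$\frac1{\mathscr K_{P,m}}$ is a hereditary polynomial'' means that $\frac1{\mathscr K_{P,m}(z,w)}$ is a polynomial in $z$ and $\overline w$; by the form of the kernel it can then be written $\frac1{\mathscr K_{P,m}(z,w)}=\sum_{\alpha\in F}a_\alpha\overline w^\alpha z^\alpha$ with $F\subset\mathbb Z_+^n$ finite. For a commuting $n$-tuple $T$ on a Hilbert space put $\frac1{\mathscr K_{P,m}}(T,T^* )=\sum_{\alpha\in F}a_\alpha T^{*\alpha}T^\alpha$, where $T^\alpha=T_1^{\alpha_1}\cdots T_n^{\alpha_n}$ and $T^{*\alpha}=(T^\alpha)^*$. $T$ is a $\triangle^n_P$-contraction of order $m$ if $\frac1{\mathscr K_{P,m}}(T,T^* )\ge0$. *)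

(* Defs.v *)
From HB Require Import structures.
From mathcomp Require Import all_boot all_order all_algebra.
From mathcomp Require Import complex mpoly.
From mathcomp Require Import boolp classical_sets reals topology normedtype derive.

Set Implicit Arguments.
Unset Strict Implicit.
Unset Printing Implicit Defensive.

Import Order.TTheory GRing.Theory Num.Theory.
Import numFieldNormedType.Exports.

Local Open Scope classical_set_scope.
Local Open Scope ring_scope.

(* In the order of [Cx R], [0 <= x] and [x < 1] include that [x] is real. *)
Definition Cx (R : realType) : numClosedFieldType := R[i]%C.

Section Triangle.
Variables (R : realType) (n : nat).
Local Notation C := (Cx R).
Implicit Types (z w : 'rV[C]_n) (P : 'I_n -> {mpoly C[n]}) (m : 'I_n -> nat).

Definition positive_regular P : Prop :=
  forall j, (forall alpha, 0 <= (P j)@_alpha) /\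
    exists (a : C) (N : nat) (Q : nat -> {mpoly C[n]}),
      [/\ 0 < a, forall k, Q k \is k.-homog &
          P j = a *: 'X_j + \sum_(2 <= k < N.+1) Q k].

(* Coordinates are numbered from 0; [insub i.+1] is [None] exactly at the last
   coordinate. *)
Definition phi z : 'rV[C]_n :=
  \row_i (if insub i.+1 is Some j then z 0 i / z 0 (j : 'I_n) else z 0 i).

(* z <> conj(w) *)
Definition hermitian_diamond z w : 'I_n -> C := fun i => z 0 i * (w 0 i)^*.

Definition triangle P : set 'rV[C]_n :=
  [set z : 'rV[C]_n | (forall j : 'I_n, (0 < j)%N -> z 0 j != 0) /\
           (forall j, (P j).@[hermitian_diamond (phi z) (phi z)] < 1)].

Definition triangle_kernel P m z w : C :=
  (\prod_(j < n | (0 < j)%N) (z 0 j * (w 0 j)^*)^-1) *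
  \prod_(j < n) ((1 - (P j).@[hermitian_diamond (phi z) (phi w)]) ^+ m j)^-1.

(* The variables of [p] are [z_1, ..., z_n] followed by the conjugates of
   [w_1, ..., w_n]. *)
Definition hereditary_polynomial (D : set 'rV[C]_n)
    (L : 'rV[C]_n -> 'rV[C]_n -> C) : Prop :=
  exists p : {mpoly C[n + n]}, forall z w, D z -> D w ->
    L z w = p.@[fun k => match split k with
                         | inl i => z 0 i
                         | inr i => (w 0 i)^*
                         end].

(* The finite family (a_alpha), alpha in F, is encoded as the polynomial with
   these coefficients.  When [D] is nonempty and open there is at most one such
   family. *)
Definition hereditary_expansion (D : set 'rV[C]_n)
    (L : 'rV[C]_n -> 'rV[C]_n -> C) (a : {mpoly C[n]}) : Prop :=
  forall z w, D z -> D w ->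
    L z w = \sum_(alpha <- msupp a) a@_alpha *
              (\prod_(i < n) (w 0 i)^* ^+ alpha i) *
              (\prod_(i < n) z 0 i ^+ alpha i).

End Triangle.

Section Operators.
Variables (R : realType) (n : nat) (H : completeNormedModType (Cx R)).
Variable dot : {dot H for Num.conj}.
Local Notation C := (Cx R).
Implicit Types (T : 'I_n -> H -> H) (alpha : 'X_{1..n}).

Definition bounded_operator (A : H -> H) : Prop :=
  linear A /\ exists c : C, forall u, `|A u| <= c * `|u|.

(* [dot] is linear in its first argument.  The value is unique when it exists,
   and it exists for every bounded [A] by the Riesz representation theorem. *)
Definition adjoint (A : H -> H) : H -> H :=
  fun v => xget 0 [set x | forall u, dot (A u) v = dot u x].

Definition op_pow T alpha : H -> H :=
  \big[(fun A B : H -> H => A \o B)/id]_(i < n) iter (alpha i) (T i).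

Definition hereditary_calculus (a : {mpoly C[n]}) T : H -> H :=
  fun u => \sum_(alpha <- msupp a)
             a@_alpha *: adjoint (op_pow T alpha) (op_pow T alpha u).

Definition positive_operator (A : H -> H) : Prop := forall u, 0 <= dot (A u) u.

Definition triangle_contraction (P : 'I_n -> {mpoly C[n]}) (m : 'I_n -> nat)
    T : Prop :=
  [/\ forall j, bounded_operator (T j),
      forall i j u, T i (T j u) = T j (T i u) &
      exists2 a : {mpoly C[n]},
        hereditary_expansion (triangle P)
          (fun z w => (triangle_kernel P m z w)^-1) a &
        positive_operator (hereditary_calculus a T)].

(* [H] is the space of functions [ev f] restricted to [D]; values of [ev f]
   outside [D] are irrelevant.  [differentiable] is over the field [C], hence
   it is holomorphy on the open set [D]. *)
Record is_rkhs (ev : H -> 'rV[C]_n -> C) (D : set 'rV[C]_n)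
    (K : 'rV[C]_n -> 'rV[C]_n -> C) : Prop := IsRKHS {
  rkhs_norm : forall f, dot f f = `|f| ^+ 2;
  rkhs_linear : forall c f g z, D z -> ev (c *: f + g) z = c * ev f z + ev g z;
  rkhs_inj : forall f g, (forall z, D z -> ev f z = ev g z) -> f = g;
  rkhs_holomorphic : forall f z, D z ->
    differentiable (ev f : 'rV[C]_n -> C^o) z;
  rkhs_reproducing : forall w, D w -> exists2 k : H,
    forall z, D z -> ev k z = K z w & forall f, ev f w = dot f k }.

(* Multiplication by [g]: the unique element of [H] equal to [g * f] on [D],
   which exists for all [f] when [g] is a multiplier. *)
Definition mult_op (ev : H -> 'rV[C]_n -> C) (D : set 'rV[C]_n)
    (g : 'rV[C]_n -> C) : H -> H :=
  fun f => xget 0 [set h | forall z, D z -> ev h z = g z * ev f z].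

End Operators.

(* Main.v *)
(* Put u = phi(z), v = phi(w) and t = u <> conj(v).  As P_i has nonnegative
   coefficients and linear part a_i t_i, the kernel
   (1 - a_i t_i) / (1 - P_i(t)) = 1 + (P_i(t) - a_i t_i) / (1 - P_i(t))
   is a limit of finite sums of rank one kernels f(z) conj(f(w)).  Hence so is
   (1 - a_i t_i) K, and the positivity of this kernel says that u_i is a
   multiplier.  As z_i = u_i ... u_n, every z_i is a multiplier as well, and the
   adjoint of multiplication by z_i maps the kernel function k_w to
   conj(w_i) k_w.  Therefore
   <(1/K)(T, T^* ) k_w, k_z> = (1/K)(z, w) K(z, w) = 1, so the quadratic form of
   (1/K)(T, T^* ) at a finite combination of kernel functions is the squared
   modulus of the sum of its coefficients.  Kernel functions span a dense
   subspace and the form is continuous.  That the polynomial 1/K has only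
   monomials z^alpha conj(w)^alpha comes from its invariance under
   coordinatewise rotations. *)
Require Import Defs.
From mathcomp Require Import all_boot all_order all_algebra.
From mathcomp Require Import cyclic separable cyclotomic.
From mathcomp Require Import complex mpoly.
From mathcomp Require Import boolp classical_sets reals topology normedtype derive.
From mathcomp Require Import sequences ring.

Set Implicit Arguments.
Unset Strict Implicit.
Unset Printing Implicit Defensive.

Import Order.TTheory GRing.Theory Num.Theory.
Import numFieldNormedType.Exports.

Local Open Scope classical_set_scope.
Local Open Scope ring_scope.

(** * Sums of rank one kernels and their limits *)

(* Nonnegativity is the closed condition |x| = x. *)
Lemma closed_num_ge0 (K : numFieldType) : closed [set x : K | 0 <= x].
Proof.
have -> : [set x : K | 0 <= x] = (fun x : K => `|x| - x) @^-1` [set 0].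
  by apply/seteqP; split=> x /=; [move=> /ger0_norm ->; rewrite subrr|
    move=> /eqP; rewrite subr_eq0 => /eqP <-].
apply: preimage_closed; last first.
  apply: accessible_closed_set1; apply: hausdorff_accessible.
  exact: norm_hausdorff.
move=> x _; apply: continuousB; last exact: cvg_id.
exact: norm_continuous.
Qed.

Section Sos.
Variables (R : realType) (T : eqType).
Local Notation C := (Cx R).
Implicit Types (D : set T) (K L : T -> T -> C).

(** Positive semidefiniteness in factored form, so that closure under sums and products needs no
    matrix argument. *)
Definition sos L : Prop := exists fs : seq (T -> C),
  forall z w, L z w = \sum_(f <- fs) f z * (f w)^*.

Lemma sos_rank1 (f : T -> C) : sos (fun z w => f z * (f w)^*).
Proof. by exists [:: f] => z w; rewrite big_seq1. Qed.

Lemma eq_sos K L : (forall z w, K z w = L z w) -> sos K -> sos L.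
Proof. by move=> e [fs E]; exists fs => z w; rewrite -e. Qed.

Lemma sosC (c : C) : 0 <= c -> sos (fun _ _ => c).
Proof.
move=> c0; apply: eq_sos (sos_rank1 (fun _ => sqrtC c)) => _ _.
by rewrite -normCK ger0_norm ?sqrtC_ge0// sqrtCK.
Qed.

Lemma sosD K L : sos K -> sos L -> sos (fun z w => K z w + L z w).
Proof.
by move=> [fs Ef] [gs Eg]; exists (fs ++ gs) => z w; rewrite big_cat Ef Eg.
Qed.

(** The Schur product theorem for factored kernels: pairwise products of the two families factor the
    product. *)
Lemma sosM K L : sos K -> sos L -> sos (fun z w => K z w * L z w).
Proof.
move=> [fs Ef] [gs Eg]; exists [seq (fun z => f z * g z) | f <- fs, g <- gs].
move=> z w; rewrite big_allpairs_dep /= Ef Eg big_distrl/=.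
apply: eq_bigr => f _; rewrite big_distrr/=; apply: eq_bigr => g _.
by rewrite rmorphM/=; ring.
Qed.

Lemma sos_sum (I : Type) (s : seq I) (F : I -> T -> T -> C) :
  (forall i, sos (F i)) -> sos (fun z w => \sum_(i <- s) F i z w).
Proof.
move=> sF; elim: s => [|i s ih].
  by apply: eq_sos (sosC (lexx 0)) => z w; rewrite big_nil.
by apply: eq_sos (sosD (sF i) ih) => z w; rewrite big_cons.
Qed.

Lemma sos_exp K n : sos K -> sos (fun z w => K z w ^+ n).
Proof.
move=> sK; elim: n => [|n ih]; first exact: sosC ler01.
by apply: eq_sos (sosM sK ih) => z w; rewrite exprS.
Qed.

(* The pointwise Cauchy-Schwarz inequality, weakened by AM-GM to an additive
   form. *)
Lemma sos_norm_le L z w : sos L -> `|L z w| *+ 2 <= L z z + L w w.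
Proof.
move=> [fs E]; rewrite !E -big_split/=.
apply: (@le_trans _ _ ((\sum_(f <- fs) `|f z * (f w)^*|) *+ 2)).
  by rewrite lerMn2r ler_norm_sum orbT.
rewrite -sumrMnl; apply: ler_sum => f _; rewrite normrM norm_conjC -!normCK.
have : 0 <= (`|f z| - `|f w|) ^+ 2.
  by apply: real_exprn_even_ge0 => //; rewrite rpredB ?normr_real.
by rewrite sqrrB addrAC subr_ge0.
Qed.

(** Convergence is asked on [D] only, since the geometric series to be used may diverge
    elsewhere. *)
Definition sos_limit D L : Prop := exists2 S : nat -> T -> T -> C,
  forall N, sos (S N) &
  forall z w, D z -> D w -> S N z w @[N --> \oo] --> (L z w : C).

Lemma eq_sos_limit D K L :
  (forall z w, D z -> D w -> K z w = L z w) -> sos_limit D K -> sos_limit D L.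
Proof.
move=> e [S sS cS]; exists S; first by [].
move=> z w Dz Dw; rewrite -(e z w Dz Dw); exact (cS z w Dz Dw).
Qed.

Lemma sos_sos_limit D L : sos L -> sos_limit D L.
Proof.
move=> sL; exists (fun _ => L); first by [].
move=> z w _ _; exact: cvg_cst.
Qed.

Lemma sos_limitD D K L : sos_limit D K -> sos_limit D L ->
  sos_limit D (fun z w => K z w + L z w).
Proof.
move=> [S sS cS] [U sU cU]; exists (fun N z w => S N z w + U N z w).
  by move=> N; apply: sosD; [exact (sS N)|exact (sU N)].
by move=> z w Dz Dw; apply: cvgD; [exact (cS z w Dz Dw)|exact (cU z w Dz Dw)].
Qed.

Lemma sos_limitM D K L : sos_limit D K -> sos_limit D L ->
  sos_limit D (fun z w => K z w * L z w).
Proof.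
move=> [S sS cS] [U sU cU]; exists (fun N z w => S N z w * U N z w).
  by move=> N; apply: sosM; [exact (sS N)|exact (sU N)].
by move=> z w Dz Dw; apply: cvgM; [exact (cS z w Dz Dw)|exact (cU z w Dz Dw)].
Qed.

Lemma sos_limit_prod D (I : Type) (s : seq I) (F : I -> T -> T -> C) :
  (forall i, sos_limit D (F i)) ->
  sos_limit D (fun z w => \prod_(i <- s) F i z w).
Proof.
move=> sF; elim: s => [|i s ih].
  apply: eq_sos_limit (sos_sos_limit _ (sosC ler01)) => z w _ _.
  by rewrite big_nil.
by apply: eq_sos_limit (sos_limitM (sF i) ih) => z w _ _; rewrite big_cons.
Qed.

Lemma sos_limit_exp D K n : sos_limit D K -> sos_limit D (fun z w => K z w ^+ n).
Proof.
move=> sK; elim: n => [|n ih]; first exact/sos_sos_limit/sosC/ler01.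
by apply: eq_sos_limit (sos_limitM sK ih) => z w _ _; rewrite exprS.
Qed.

Lemma cvg_exprn_Cx (x : C) : `|x| < 1 -> x ^+ N @[N --> \oo] --> (0 : C).
Proof.
move=> x1; have xE : `|x| = (complex.Re `|x|)%:C%C by rewrite RRe_real ?normr_real.
set r := complex.Re `|x| in xE.
have r0 : 0 <= r by rewrite -(lecR 0) -xE; exact: normr_ge0.
have r1 : `|r| < 1 by rewrite ger0_norm// -ltcR -xE; exact: x1.
have /cvgrPdist_lt cr := cvg_geometric 1 r1; apply/cvgrPdist_lt => e e0.
(* A positive element of [C] is real, so the tolerance transfers to the real geometric sequence. *)
have eE : e = (complex.Re e)%:C%C by rewrite RRe_real ?gtr0_real.
have e0' : 0 < complex.Re e by rewrite -(ltcR 0) -eE; exact: e0.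
apply: filterS (cr _ e0') => N; rewrite !sub0r !normrN /geometric/= mul1r.
rewrite normrX (ger0_norm r0) => h.
by rewrite normrX xE eE -rmorphXn/= ltcR.
Qed.

(** The partial sums of the geometric series are polynomials in [Q] with nonnegative
    coefficients. *)
Lemma sos_limit_geometric D Q : sos Q ->
  (forall z w, D z -> D w -> `|Q z w| < 1) ->
  sos_limit D (fun z w => (1 - Q z w)^-1).
Proof.
move=> sQ Q1; exists (fun N z w => \sum_(k < N) Q z w ^+ k).
  by move=> N; apply: sos_sum => k; exact: sos_exp.
move=> z w Dz Dw; have q1 := Q1 _ _ Dz Dw; set q := Q z w in q1 *.
have nz : 1 - q != 0.
  by rewrite subr_eq0; apply: contraTneq q1 => <-; rewrite normr1 ltxx.
have -> : (fun N => \sum_(k < N) q ^+ k) = (fun N => (1 - q ^+ N) * (1 - q)^-1).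
  apply/funext => N; apply: (canRL (mulfK nz)).
  by rewrite mulrC -[RHS]opprB subrX1 -mulNr opprB.
rewrite -[X in _ --> X]mul1r; apply: (@cvgMl _ _ _ _ (fun N => 1 - q ^+ N)).
rewrite -[X in _ --> X]subr0; apply: cvgB; first exact: cvg_cst.
exact: cvg_exprn_Cx.
Qed.

(** With the arguments in the order [L q.2 p.2], the form of a reproducing kernel is the squared
    norm of the combination of the [k p.2] with coefficients [p.1]. *)
Definition psd D L : Prop := forall s : seq (C * T),
  {in s, forall p, D p.2} ->
  0 <= \sum_(p <- s) \sum_(q <- s) p.1 * q.1^* * L q.2 p.2.

Lemma sos_psd D L : sos L -> psd D L.
Proof.
move=> [fs E] s _.
under eq_bigr do under eq_bigr do rewrite E big_distrr/=.
under eq_bigr do rewrite exchange_big/=.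
rewrite exchange_big/= sumr_ge0// => f _.
rewrite (_ : \sum_(_ <- _) _ = `|\sum_(p <- s) p.1^* * f p.2| ^+ 2) ?exprn_ge0//.
rewrite normCK rmorph_sum big_distrr/=; apply: eq_bigr => p _.
rewrite big_distrl/=; apply: eq_bigr => q _.
by rewrite rmorphM/= conjCK; ring.
Qed.

Lemma sos_limit_psd D L : sos_limit D L -> psd D L.
Proof.
move=> [S sS cS] s Ds.
pose u N : C := \sum_(p <- s) \sum_(q <- s) p.1 * q.1^* * S N q.2 p.2.
apply: (@closed_cvg _ _ \oo _ u _ (@closed_num_ge0 C)); rewrite {}/u.
  by apply: nearW => N; exact: sos_psd (sS N) s Ds.
(* Membership in [s] is recorded because [S] is known to converge only at points of [D]. *)
rewrite big_seq.
under [in X in X @ _]eq_fun do rewrite big_seq.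
apply: cvg_big => [|p ps]; first exact: add_continuous.
rewrite big_seq.
under [in X in X @ _]eq_fun do rewrite big_seq.
apply: cvg_big => [|q qs]; first exact: add_continuous.
by apply: cvgMr; apply: cS; exact: Ds.
Qed.

End Sos.

(** * The kernel of the triangle *)

Lemma sos_mpoly (R : realType) (T : eqType) n (p : {mpoly (Cx R)[n]})
    (f : T -> 'I_n -> Cx R) : (forall alpha, 0 <= p@_alpha) ->
  sos (fun z w => p.@[fun i => f z i * (f w i)^*]).
Proof.
move=> p0; apply: (eq_sos (K := fun z w => \sum_(alpha <- msupp p)
    p@_alpha * ((\prod_i f z i ^+ alpha i) * (\prod_i f w i ^+ alpha i)^*))).
  move=> z w; rewrite mevalE; apply: eq_bigr => alpha _; congr (_ * _).
  rewrite rmorph_prod -big_split/=; apply: eq_bigr => i _.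
  by rewrite rmorphXn -exprMn.
apply: sos_sum => alpha; apply: sosM (sosC _ (p0 alpha)) _.
exact: (sos_rank1 (fun z => \prod_i f z i ^+ alpha i)).
Qed.

Section TriangleKernel.
Variables (R : realType) (n : nat) (P : 'I_n -> {mpoly (Cx R)[n]}).
Hypothesis posregP : positive_regular P.
Variable m : 'I_n -> nat.
Hypothesis m_gt0 : forall j, (0 < m j)%N.
Local Notation C := (Cx R).
Implicit Types (z w : 'rV[C]_n) (i j : 'I_n).
Local Notation D := (triangle P).
Local Notation K := (triangle_kernel P m).
Local Notation q j z w := ((P j).@[hermitian_diamond (phi z) (phi w)]).

(** Subtracting the linear term changes only the coefficient of ['X_j], to which the homogeneous
    parts of degree at least 2 contribute nothing. *)
Lemma positive_regular_linear j : exists2 a : C, 0 < a &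
  forall alpha, 0 <= (P j - a *: 'X_j)@_alpha.
Proof.
have [P0 [a [N [Q [a0 Qh PE]]]]] := posregP j; exists a => // alpha.
have [<-|ne] := eqVneq U_(j)%MM alpha.
  rewrite PE (addrC (a *: 'X_j)) addrK raddf_sum/= big_nat.
  rewrite sumr_ge0// => k /andP[k2 _].
  rewrite (dhomog_nemf_coeff (Qh k))//= mdeg1.
  by rewrite neq_ltn k2.
by rewrite mcoeffB mcoeffZ mcoeffX (negPf ne) mulr0 subr0.
Qed.

Lemma sos_triangle_poly j : sos (fun z w => q j z w).
Proof.
by apply: (sos_mpoly (fun z i => phi z 0 i)) => alpha; apply: (posregP j).1.
Qed.

(** The diagonal bounds control the other values: [2 |q j z w| <= q j z z + q j w w < 2]. *)
Lemma triangle_poly_lt1 j z w : D z -> D w -> `|q j z w| < 1.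
Proof.
move=> [_ /(_ j) z1] [_ /(_ j) w1].
have := sos_norm_le z w (sos_triangle_poly j).
move/le_lt_trans => /(_ _ (ltrD z1 w1)).
by rewrite -mulr2n -[in ltRHS](mulr1n 1) -mulrnA ltrMn2r /=.
Qed.

Lemma triangle_poly_neq1 j z w : D z -> D w -> 1 - q j z w != 0.
Proof.
move=> Dz Dw; rewrite subr_eq0; apply: contraTneq (triangle_poly_lt1 j Dz Dw).
by move=> <-; rewrite normr1 ltxx.
Qed.

Lemma triangle_kernel_neq0 z w : D z -> D w -> K z w != 0.
Proof.
move=> Dz Dw; rewrite mulf_neq0//; apply/prodf_neq0 => j j0.
  by rewrite invr_eq0 mulf_neq0 ?conjC_eq0//; [apply: Dz.1|apply: Dw.1].
by rewrite invr_eq0 expf_neq0// triangle_poly_neq1.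
Qed.

Lemma sos_limit_coord_contraction i : exists2 a : C, 0 < a &
  sos_limit D (fun z w => (1 - a * (phi z 0 i * (phi w 0 i)^*)) * K z w).
Proof.
have [a a0 Q0] := positive_regular_linear i; exists a => //.
have geo j : sos_limit D (fun z w => (1 - q j z w)^-1).
  apply: sos_limit_geometric (sos_triangle_poly j) _ => z w.
  exact: triangle_poly_lt1.
(* The factor [1 - a t_i] is absorbed into one of the [m i] copies of [1 / (1 - P_i)], which exists
   because [m i] is positive. *)
pose F j z w : C := if j == i then
    (1 + (P j - a *: 'X_j).@[hermitian_diamond (phi z) (phi w)] *
      (1 - q j z w)^-1) * (1 - q j z w)^-1 ^+ (m j).-1
  else (1 - q j z w)^-1 ^+ m j.
pose r z : C := \prod_(j < n | (0 < j)%N) (z 0 j)^-1.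
apply: (eq_sos_limit (K := fun z w => r z * (r w)^* * \prod_j F j z w)).
  move=> z w Dz Dw; rewrite /triangle_kernel mulrCA; congr (_ * _).
    rewrite /r rmorph_prod -big_split/=; apply: eq_bigr => j _.
    by rewrite fmorphV -invfM.
  rewrite (bigD1 i)//= [in RHS](bigD1 i)//= [RHS]mulrA; congr (_ * _); last first.
    by apply: eq_bigr => j ji; rewrite /F (negPf ji) exprVn.
  rewrite /F eqxx -[in RHS](prednK (m_gt0 i)) exprS invfM -exprVn [RHS]mulrA.
  congr (_ * _); have nz := triangle_poly_neq1 i Dz Dw.
  rewrite mevalB mevalZ mevalXU /hermitian_diamond.
  by apply: (canRL (mulfK nz)); rewrite mulrDl mul1r divfK//; ring.
apply: sos_limitM; first exact: sos_sos_limit (sos_rank1 r).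
apply: sos_limit_prod => j; rewrite /F.
case: eqP => [->|_]; last exact: sos_limit_exp.
apply: sos_limitM; last exact: sos_limit_exp.
apply: sos_limitD; first exact/sos_sos_limit/sosC/ler01.
apply: sos_limitM (geo i); apply: sos_sos_limit.
exact (sos_mpoly (fun z i => phi z 0 i) Q0).
Qed.

(** Undoes the division in [phi], legitimate since the denominator has index [i.+1 > 0]; the last
    coordinate gets the factor 1. *)
Lemma triangle_coord z i : D z -> z 0 i =
  phi z 0 i * (if insub i.+1 is Some j then z 0 (j : 'I_n) else 1).
Proof.
move=> Dz; rewrite mxE; case: insubP => [j _ jE|_]; last by rewrite mulr1.
by rewrite divfK//; apply: Dz.1; rewrite jE.
Qed.

(** Descending induction along [z_i = u_i z_(i+1)] with [u = phi z]: for [x = u_i conj(u_i')] and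
    [y] likewise from [z_(i+1)], [1 - a c x y = (1 - a x) + a x (1 - c y)]. *)
Lemma sos_limit_contraction i : exists2 c : C, 0 < c &
  sos_limit D (fun z w => (1 - c * (z 0 i * (w 0 i)^*)) * K z w).
Proof.
(* The induction is on [n - i], so the base case is vacuous and the last coordinate appears in the
   inductive step. *)
elim: {i}(n - i)%N {-2}i (erefl (n - i)%N) => [i|k ih i] ik.
  by have := ltn_ord i; rewrite -subn_gt0 ik.
have [a a0 Ha] := sos_limit_coord_contraction i.
have := triangle_coord i; case: insubP => [j _ jE zE|_ zE]; last first.
  exists a; first exact: a0.
  apply: eq_sos_limit Ha => z w Dz Dw.
  by rewrite (zE z Dz) (zE w Dw) !mulr1.
have [|c c0 Hc] := ih j; first by rewrite jE subnS ik.
exists (a * c); first exact: mulr_gt0.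
apply: (eq_sos_limit (K := fun z w =>
   (1 - a * (phi z 0 i * (phi w 0 i)^*)) * K z w +
   a * (phi z 0 i * (phi w 0 i)^*) * ((1 - c * (z 0 j * (w 0 j)^*)) * K z w))).
  by move=> z w Dz Dw; rewrite (zE z Dz) (zE w Dw) rmorphM/=; ring.
apply: sos_limitD Ha _; apply: sos_limitM Hc; apply: sos_sos_limit.
apply: sosM; first exact: sosC (ltW a0).
exact (sos_rank1 (fun z => phi z 0 i)).
Qed.

End TriangleKernel.

(** * Diagonal form of a rotation-invariant hereditary polynomial *)

Section RootsOfUnity.
Variable C : numClosedFieldType.
Implicit Types omega : C.

(** In characteristic 0 the polynomial ['X^N - 1] is separable, and [N] distinct [N]-th roots of
    unity include a primitive one. *)
Lemma prim_root_exists N : (0 < N)%N -> exists omega, N.-primitive_root omega.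
Proof.
pose p : {poly C} := 'X^N - 1; have [r Dp] := closed_field_poly_normal p.
move=> N_gt0; rewrite (monicP _) ?monicXnsubC // scale1r in Dp.
have rn1: all N.-unity_root r by apply/allP=> z; rewrite -root_prod_XsubC -Dp.
have sz_r: (N < (size r).+1)%N.
  by rewrite -(size_prod_XsubC r id) -Dp size_XnsubC.
have [|z] := hasP (has_prim_root N_gt0 rn1 _ sz_r); last by exists z.
by rewrite -separable_prod_XsubC -Dp separable_Xn_sub_1 // pnatr_eq0 -lt0n.
Qed.

Lemma norm_prim_root N omega : N.-primitive_root omega -> `|omega| = 1.
Proof.
move=> prim; apply/eqP; rewrite -(@pexpr_eq1 _ _ N) ?(prim_order_gt0 prim)//.
by rewrite -normrX (prim_expr_order prim) normr1.
Qed.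

(** Orthogonality of characters: a geometric sum of ratio [x] with [x ^+ N = 1], where [x = 1]
    forces [a = b] because both exponents are below [N]. *)
Lemma sum_prim_root N omega a b : N.-primitive_root omega ->
  (a < N)%N -> (b < N)%N ->
  \sum_(k < N) (omega ^+ k) ^+ a * ((omega ^+ k)^*) ^+ b =
    if a == b then N%:R else 0 :> C.
Proof.
move=> prim aN bN; have o1 : omega * omega^* = 1.
  by rewrite -normCK (norm_prim_root prim) expr1n.
pose x := omega ^+ a * omega^* ^+ b.
rewrite (eq_bigr (fun k : 'I_N => x ^+ k)); last first.
  by move=> k _; rewrite rmorphXn/= exprMn -!exprM !(mulnC k).
have xN : x ^+ N = 1.
  rewrite exprMn exprAC [X in _ * X]exprAC -rmorphXn/=.
  by rewrite (prim_expr_order prim) conjC1 !expr1n mulr1.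
have [ab|ab] := eqVneq a b.
  rewrite /x ab -exprMn o1 expr1n; under eq_bigr do rewrite expr1n.
  by rewrite sumr_const card_ord.
have x1 : x - 1 != 0.
  rewrite subr_eq0; apply: contraNneq ab => x1.
  have : omega ^+ a = omega ^+ b.
    by rewrite -[RHS]mul1r -x1 -mulrA -exprMn (mulrC omega^*) o1 expr1n mulr1.
  by move/eqP; rewrite (eq_prim_root_expr prim) !modn_small.
by apply: (mulfI x1); rewrite mulr0 -subrX1 xN subrr.
Qed.
End RootsOfUnity.

(** * Invariance under rotations and averaging over the torus *)

Section Rotation.
Variables (R : realType) (n : nat) (P : 'I_n -> {mpoly (Cx R)[n]}).
Variable m : 'I_n -> nat.
Local Notation C := (Cx R).
Implicit Types (z w : 'rV[C]_n) (c : 'I_n -> C).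

Definition rotate c z : 'rV[C]_n := \row_i (c i * z 0 i).

(** Each coordinate of [phi] picks up a unimodular factor, [c i / c j] or [c i], which cancels
    against its conjugate. *)
Lemma hermitian_diamond_rotate c z w : (forall i, `|c i| = 1) ->
  hermitian_diamond (phi (rotate c z)) (phi (rotate c w)) =
  hermitian_diamond (phi z) (phi w).
Proof.
move=> c1; have cc i : c i * (c i)^* = 1 by rewrite -normCK c1 expr1n.
apply/funext => i; rewrite /hermitian_diamond !mxE; case: insubP => [j _ _|_].
  rewrite !mxE !rmorphM/= !fmorphV/= !rmorphM/= !invfM.
  transitivity ((c i * (c i)^*) * (c j * (c j)^*)^-1 *
    (z 0 i / z 0 j * ((w 0 i)^* * ((w 0 j)^*)^-1))); last first.
    by rewrite !cc invr1 !mul1r.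
  by rewrite invfM; ring.
by rewrite rmorphM/= mulrACA cc mul1r.
Qed.

Lemma triangle_rotate c z : (forall i, `|c i| = 1) ->
  triangle P z -> triangle P (rotate c z).
Proof.
move=> c1 [z0 zP]; split=> j; last by rewrite hermitian_diamond_rotate.
by move=> /z0 zj; rewrite mxE mulf_neq0// -normr_eq0 c1 oner_eq0.
Qed.

Lemma triangle_kernel_rotate c z w : (forall i, `|c i| = 1) ->
  triangle_kernel P m (rotate c z) (rotate c w) = triangle_kernel P m z w.
Proof.
move=> c1; rewrite /triangle_kernel hermitian_diamond_rotate//; congr (_ * _).
apply: eq_bigr => i _; rewrite !mxE rmorphM/= mulrACA -normCK c1 expr1n.
by rewrite mul1r.
Qed.

(* Averaging over a finite torus of N-th roots of unity kills the monomials
   z^alpha (w^* )^beta with alpha != beta. *)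
Lemma hereditary_polynomial_expansion (L : 'rV[C]_n -> 'rV[C]_n -> C)
    (D : set 'rV[C]_n) :
  (forall c z, (forall i, `|c i| = 1) -> D z -> D (rotate c z)) ->
  (forall c z w, (forall i, `|c i| = 1) -> L (rotate c z) (rotate c w) = L z w) ->
  hereditary_polynomial D L -> exists a, hereditary_expansion D L a.
Proof.
move=> Drot Lrot [p pE].
pose diag (alpha : 'X_{1..n + n}) :=
  [forall i, alpha (lshift n i) == alpha (rshift n i)].
pose left_part (alpha : 'X_{1..n + n}) :=
  [multinom alpha (lshift n i) | i < n].
(* The diagonal part of [p], with each pair of equal exponents merged into one. *)
pose a : {mpoly C[n]} :=
  \sum_(alpha <- msupp p | diag alpha) p@_alpha *: 'X_[left_part alpha].
exists a => z w Dz Dw.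
have -> : \sum_(alpha <- msupp a) a@_alpha *
     \prod_(i < n) (w 0 i)^* ^+ alpha i * \prod_(i < n) z 0 i ^+ alpha i =
   a.@[fun i => z 0 i * (w 0 i)^*].
  rewrite mevalE; apply: eq_bigr => alpha _; rewrite -mulrA; congr (_ * _).
  by rewrite -big_split/=; apply: eq_bigr => i _; rewrite mulrC exprMn.
(* Every exponent occurring in [p] is below [N], as the orthogonality relation requires. *)
pose N := (msize p).+1.
have [omega prim] : exists omega : C, N.-primitive_root omega.
  exact: prim_root_exists.
pose c (f : {ffun 'I_n -> 'I_N}) i := omega ^+ f i.
have c1 f i : `|c f i| = 1 by rewrite normrX (norm_prim_root prim) expr1n.
have Nn0 : (N ^ n)%:R != 0 :> C by rewrite pnatr_eq0 -lt0n expn_gt0.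
apply: (mulfI Nn0).
transitivity (\sum_(f : {ffun 'I_n -> 'I_N}) L (rotate (c f) z) (rotate (c f) w)).
  under eq_bigr do rewrite Lrot//.
  by rewrite sumr_const card_ffun !card_ord mulr_natl.
pose v alpha : C := \prod_(i < n) z 0 i ^+ alpha (lshift n i) *
                \prod_(i < n) (w 0 i)^* ^+ alpha (rshift n i).
transitivity (\sum_(f : {ffun 'I_n -> 'I_N}) \sum_(alpha <- msupp p)
    p@_alpha * v alpha * \prod_(i < n) ((omega ^+ f i) ^+ alpha (lshift n i) *
                     (omega ^+ f i)^* ^+ alpha (rshift n i))).
  apply: eq_bigr => f _; rewrite pE; [|exact: Drot..].
  rewrite mevalE; apply: eq_bigr => alpha _; rewrite -mulrA; congr (_ * _).
  rewrite big_split_ord/= /v -!big_split/=.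
  by apply: eq_bigr => i _; rewrite (unsplitK (inl i)) (unsplitK (inr i)) !mxE
     rmorphM/= !exprMn /c; ring.
rewrite exchange_big/= [in RHS]raddf_sum mulr_sumr/= [in RHS]big_mkcond/=.
apply: eq_big_seq => alpha alphap; rewrite -mulr_sumr.
have alphaN i : (alpha i < N)%N.
  by rewrite ltnW// ltnS (leq_ltn_trans _ (msize_mdeg_lt alphap))// mdegE
    (bigD1 i)//= leq_addr.
(* The sum over the finite torus factors into one sum over roots of unity per coordinate. *)
rewrite -(bigA_distr_bigA (fun i (k : 'I_N) => (omega ^+ k) ^+ alpha (lshift n i) *
   (omega ^+ k)^* ^+ alpha (rshift n i))).
under eq_bigr do rewrite (sum_prim_root prim)//.
case: ifPn => [/forallP dg|].
  rewrite (eq_bigr (fun=> N%:R)) => [|i _]; last by rewrite dg.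
  rewrite prodr_const card_ord -natrX mulrC; congr (_ * _).
  rewrite mevalZ mevalX; congr (_ * _); rewrite /v -big_split/=.
  by apply: eq_bigr => i _; rewrite -(eqP (dg i)) mnmE exprMn.
rewrite negb_forall => /existsP[i /negPf ni].
by rewrite (bigD1 i)//= ni mul0r mulr0.
Qed.

End Rotation.

(** * Hilbert spaces *)

(** The order of [C] is partial, but all elements of [A] differ from [b] by a nonnegative real, so
    the infimum is taken in [R] and shifted back. *)
Lemma Cx_inf_exists (R : realType) (A : set (Cx R)) (b : Cx R) : A !=set0 ->
  (forall x, A x -> b <= x) ->
  exists2 d : Cx R, (forall x, A x -> d <= x) &
    forall e, 0 < e -> exists2 x, A x & x < d + e.
Proof.
move=> [x0 Ax0] bA.
have real_diff x : A x -> x - b = (complex.Re (x - b))%:C%C.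
  by move=> Ax; rewrite RRe_real// ger0_real// subr_ge0 bA.
pose E : set R := [set complex.Re (x - b) | x in A].
have lbE : lbound E 0.
  move=> _ [x Ax <-]; rewrite -(lecR 0) -real_diff//.
  by have := bA x Ax; rewrite -subr_ge0.
have hE : has_inf E by split; [exists (complex.Re (x0 - b)); exists x0|exists 0].
exists (b + (inf E)%:C%C) => [x Ax|e e0].
  rewrite -lerBrDl (real_diff x Ax) lecR; apply: inf_lbound; last by exists x.
  by exists 0.
have eE : e = (complex.Re e)%:C%C by rewrite RRe_real ?gtr0_real.
have e0' : 0 < complex.Re e by rewrite -(ltcR 0) -eE; exact: e0.
have [_ [x Ax <-] xlt] := inf_adherent e0' hE.
exists x => //; rewrite -addrA -ltrBlDl (real_diff x Ax) eE -rmorphD/= ltcR.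
by [].
Qed.

Section Hilbert.
Variables (R : realType) (H : completeNormedModType (Cx R)).
Variable dot : {dot H for Num.conj}.
Local Notation C := (Cx R).
Hypothesis dot_norm : forall f, dot f f = `|f| ^+ 2.
Implicit Types (u v w h : H) (A B : H -> H).

Lemma dot_conj u v : dot u v = (dot v u)^*.
Proof. by rewrite hermC expr0 mul1r. Qed.

Lemma dotDl u v w : dot (u + v) w = dot u w + dot v w.
Proof. exact: linearDl. Qed.

Lemma dotZl c u v : dot (c *: u) v = c * dot u v.
Proof. exact: linearZl_LR. Qed.

Lemma dotDr u v w : dot w (u + v) = dot w u + dot w v.
Proof. exact: linearDr. Qed.

Lemma dotZr c u v : dot v (c *: u) = c^* * dot v u.
Proof. exact: linearZr_LR. Qed.

Lemma dotNl u v : dot (- u) v = - dot u v.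
Proof. exact: linearNl. Qed.

Lemma dotNr u v : dot v (- u) = - dot v u.
Proof. exact: linearNr. Qed.

Lemma dot0l v : dot 0 v = 0.
Proof. exact: linear0l. Qed.

Lemma dot0r v : dot v 0 = 0.
Proof. exact: linear0r. Qed.

Lemma dot_suml (I : Type) (s : seq I) (F : I -> H) v :
  dot (\sum_(i <- s) F i) v = \sum_(i <- s) dot (F i) v.
Proof.
by elim: s => [|i s ih]; rewrite ?big_nil ?dot0l// !big_cons dotDl ih.
Qed.

Lemma dot_sumr (I : Type) (s : seq I) (F : I -> H) v :
  dot v (\sum_(i <- s) F i) = \sum_(i <- s) dot v (F i).
Proof.
by elim: s => [|i s ih]; rewrite ?big_nil ?dot0r// !big_cons dotDr ih.
Qed.

Lemma dot_extr u v : (forall w, dot w u = dot w v) -> u = v.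
Proof.
move=> e; apply/eqP; rewrite -subr_eq0 -normr_eq0 -sqrf_eq0 -dot_norm.
by rewrite dotDr dotNr e subrr.
Qed.

Lemma CauchySchwarz_dot u v : `|dot u v| <= `|u| * `|v|.
Proof.
have [->|v0] := eqVneq v 0; first by rewrite dot0r !normr0 mulr0.
have nv0 : 0 < `|v| by rewrite normr_gt0.
have : 0 <= dot (`|v| ^+ 2 *: u - dot u v *: v) (`|v| ^+ 2 *: u - dot u v *: v).
  by rewrite dot_norm exprn_ge0.
have -> : dot (`|v| ^+ 2 *: u - dot u v *: v) (`|v| ^+ 2 *: u - dot u v *: v) =
  `|v| ^+ 2 * ((`|u| * `|v|) ^+ 2 - `|dot u v| ^+ 2).
  rewrite !(dotDl, dotDr, dotNl, dotNr, dotZl, dotZr) !dot_norm.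
  rewrite (dot_conj v u) normCK.
  have -> : (`|v| ^+ 2)^* = `|v| ^+ 2.
    by apply: conj_Creal; rewrite rpredX// normr_real.
  ring.
by rewrite pmulr_rge0 ?exprn_gt0// subr_ge0 ler_pXn2r ?nnegrE ?mulr_ge0.
Qed.

Lemma ler0_small (K : numFieldType) (a b : K) : a \is Num.real -> 0 <= b ->
  (forall e, 0 < e -> a <= e * b) -> a <= 0.
Proof.
move=> ar b0 ab; rewrite real_leNgt ?real0//; apply/negP => a0.
have b1 : 0 < b + 1 by rewrite ltr_wpDl.
have := ab (a / (b + 1)) (divr_gt0 a0 b1).
rewrite mulrAC ler_pdivlMr// mulrDr mulr1 gerDl.
by move=> /(lt_le_trans a0); rewrite ltxx.
Qed.

(* The representing vector is the limit of the filter of near-minimisers of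
   [ |u|^2 - 2 Re x ] over the graph [G]; it is the orthogonal projection onto
   the closed domain of the Riesz representative. *)
Lemma riesz_graph (G : H -> C -> Prop) (M : C) : 0 <= M -> G 0 0 ->
  (forall c u x v y, G u x -> G v y -> G (c *: u + v) (c * x + y)) ->
  (forall u x, G u x -> `|x| <= M * `|u|) ->
  exists h, [/\ closure [set u | exists x, G u x] h, `|h| <= M &
    forall u x, G u x -> dot u h = x].
Proof.
move=> M0 G0 GD GM.
pose J u x : C := `|u| ^+ 2 - (x + x^*).
have [|x|d dJ dE] := @Cx_inf_exists R
  (* The lower bound comes from [|u|^2 - 2 Re x >= |u|^2 - 2 M |u| >= - M^2]. *)
  [set J ux.1 ux.2 | ux in [set ux | G ux.1 ux.2]] (- M ^+ 2).
- by exists (J 0 0); exists (0, 0).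
- move=> [[u {}x] /= Gux <-]; rewrite /J -subr_ge0 opprK.
  have xr : x + x^* \is Num.real.
    by rewrite CrealE rmorphD/= conjCK addrC.
  have xM : x + x^* <= 2 * (M * `|u|).
    apply: le_trans (real_ler_norm xr) _; apply: le_trans (ler_normD _ _) _.
    by rewrite norm_conjC mulr_natl mulr2n lerD ?GM.
  have -> : `|u| ^+ 2 - (x + x^*) + M ^+ 2 =
      (`|u| - M) ^+ 2 + (2 * (M * `|u|) - (x + x^*)) by ring.
  rewrite addr_ge0 ?subr_ge0//; apply: real_exprn_even_ge0 => //.
  by rewrite rpredB ?normr_real ?ger0_real.
have {}dJ u x : G u x -> d <= J u x by move=> Gux; apply: dJ; exists (u, x).
have {}dE e : 0 < e -> exists u x, G u x /\ J u x < d + e ^+ 2.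
  move=> e0; have [|_ [[u x] /= Gux <-] lt] := dE (e ^+ 2); first exact: exprn_gt0.
  by exists u, x.
(* Parallelogram law: the midpoint of two near-minimisers lies in [G] and cannot go below [d], so
   they are close to each other. *)
have half u x v y e : G u x -> G v y -> J u x < d + e ^+ 2 -> J v y < d + e ^+ 2 ->
    `|u - v| ^+ 2 < (2 * e) ^+ 2.
  move=> Gux Gvy Ju Jv.
  have Gm : G (2^-1 *: (u + v)) (2^-1 * (x + y)).
    have := GD 2^-1 _ _ _ _ (GD 1 _ _ _ _ Gux Gvy) G0.
    by rewrite scale1r mul1r !addr0.
  have := dJ _ _ Gm; rewrite -subr_ge0 => Jm.
  rewrite -subr_gt0.
  have -> : (2 * e) ^+ 2 - `|u - v| ^+ 2 = 2 * (d + e ^+ 2 - J u x) +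
     2 * (d + e ^+ 2 - J v y) + 4 * (J (2^-1 *: (u + v)) (2^-1 * (x + y)) - d).
    rewrite /J -!dot_norm !(dotDl, dotDr, dotNl, dotNr, dotZl, dotZr).
    rewrite !rmorphM/= !rmorphD/= !fmorphV/= !rmorph_nat.
    by field.
  by rewrite ltr_wpDr ?mulr_ge0// addr_gt0// mulr_gt0// subr_gt0.
(* Approximate first-order condition: moving from [u] by the optimal multiple [t] of [v] lowers [J]
   by [|delta|^2 / |v|^2], which is at most [e^2]. *)
have weak u x v y e : 0 < e -> G u x -> G v y -> J u x < d + e ^+ 2 ->
    `|dot v u - y| <= e * `|v|.
  move=> e0 Gux Gvy Ju; have [v0|v0] := eqVneq v 0.
    have := GM _ _ Gvy; rewrite v0 normr0 mulr0 normr_le0 => /eqP ->.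
    by rewrite dot0l subr0 normr0 mulr0.
  have nv0 : 0 < `|v| by rewrite normr_gt0.
  pose delta := y - dot v u; pose t := delta^* / `|v| ^+ 2.
  have := dJ _ _ (GD t _ _ _ _ Gvy Gux); rewrite -subr_ge0.
  have -> : J (t *: v + u) (t * y + x) - d =
    (J u x - d) - `|delta| ^+ 2 / `|v| ^+ 2.
    rewrite /J -![in LHS]dot_norm !(dotDl, dotDr, dotNl, dotNr, dotZl, dotZr).
    rewrite !dot_norm (dot_conj u v) normCK !rmorphD/= !rmorphM/= fmorphV/=.
    have -> : (`|v| ^+ 2)^* = `|v| ^+ 2.
    by apply: conj_Creal; rewrite rpredX// normr_real.
    rewrite conjCK /t /delta !rmorphB/=.
    field. exact: lt0r_neq0.
  rewrite subr_ge0 => dJ'; have Je : J u x - d <= e ^+ 2 by rewrite lerBlDl ltW.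
  have := le_trans dJ' Je; rewrite ler_pdivrMr ?exprn_gt0// -exprMn.
  by rewrite ler_pXn2r ?nnegrE ?mulr_ge0 ?(ltW e0)// /delta distrC.
pose F := filter_from [set e : C | 0 < e]
  (fun e => [set u | exists2 x, G u x & J u x < d + e ^+ 2]).
have FF : ProperFilter F.
  apply: filter_from_proper; last first.
    by move=> e e0; have [u [x [Gux Ju]]] := dE e e0; exists u; exists x.
  apply: filter_from_filter; first by exists 1; exact: ltr01.
  move=> i j i0 j0.
  wlog ij : i j i0 j0 / i <= j => [wl|].
    have [/(wl _ _ i0 j0)//|/ltW/(wl _ _ j0 i0)[k k0 Bk]] :=
      real_leP (gtr0_real i0) (gtr0_real j0).
    by exists k => // u /Bk[].
  exists i => // u [x Gux Ju]; split; exists x => //; apply: lt_le_trans Ju _.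
  by rewrite lerD2l ler_pXn2r ?nnegrE ?(ltW i0) ?(ltW j0).
have Fc : cauchy F.
  apply: cauchy_exP => e e0; have e20 : 0 < e / 2 by rewrite divr_gt0.
  have [u [x [Gux Ju]]] := dE _ e20; exists u, (e / 2) => // v [y Gvy Jv].
  rewrite -ball_normE /ball_/=; have := half _ _ _ _ _ Gux Gvy Ju Jv.
  have -> : 2 * (e / 2) = e by rewrite mulrC divfK// pnatr_eq0.
  by rewrite ltr_pXn2r ?nnegrE ?(ltW e0).
have /cvg_ex [h Fh] := @cauchy_cvg H F FF Fc.
have approx e : 0 < e -> exists u x, [/\ G u x, J u x < d + e ^+ 2 & `|h - u| < e].
  move=> e0; have Fb : F (ball h e) by apply: Fh; exact: nbhsx_ballx.
  have Fe : F [set u | exists2 x, G u x & J u x < d + e ^+ 2] by exists e.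
  have [u [[x Gux Ju] hu]] := filter_ex (filterI Fe Fb); exists u, x; split=> //.
  by move: hu; rewrite -ball_normE.
have rep u x : G u x -> dot u h = x.
  move=> Gux; apply/eqP; rewrite -subr_eq0 -normr_le0.
  apply: (@ler0_small _ _ (2 * `|u|)); rewrite ?normr_real ?mulr_ge0// => e e0.
  have [v [y [Gvy Jv hv]]] := approx e e0.
  rewrite (_ : dot u h - x = dot u (h - v) + (dot u v - x)); last first.
    by rewrite dotDr dotNr; ring.
  apply: le_trans (ler_normD _ _) _; rewrite mulrCA [2 * _]mulr_natl mulr2n lerD//.
    by apply: le_trans (CauchySchwarz_dot _ _) _; rewrite mulrC ler_wpM2r ?(ltW hv).
  exact: weak e0 Gvy Gux Jv.
exists h; split=> //.
  move=> B /nbhs_ballP [e e0 Be]; have [u [x [Gux _ hu]]] := approx e e0.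
  by exists u; split; [exists x|apply: Be; rewrite -ball_normE].
have [->|h0] := eqVneq h 0; first by rewrite normr0.
have nh0 : 0 < `|h| by rewrite normr_gt0.
(* For [u] within [e] of [h], [|h|^2 <= |h - u| |h| + M |u| <= e |h| + M (|h| + e)]; then [e] is
   arbitrary. *)
rewrite -(ler_pM2r nh0) -subr_le0; apply: (@ler0_small _ _ (M + `|h|)).
- by rewrite rpredB ?rpredM ?normr_real ?ger0_real.
- by rewrite addr_ge0.
move=> e e0; have [u [x [Gux _ hu]]] := approx e e0.
have nu : `|u| <= `|h| + e.
  by rewrite -lerBlDl (le_trans _ (ltW hu))// distrC lerB_dist.
have -> : `|h| * `|h| = `|dot (h - u) h + x|.
  by rewrite dotDl dotNl (rep _ _ Gux) subrK dot_norm normrX normr_id expr2.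
rewrite lerBlDr; apply: le_trans (ler_normD _ _) _.
rewrite mulrDr (addrC (e * M)) -addrA lerD//.
  by apply: le_trans (CauchySchwarz_dot _ _) _; rewrite ler_wpM2r ?(ltW hu).
apply: le_trans (GM _ _ Gux) _; rewrite addrC (mulrC e) -mulrDr ler_wpM2l//.
Qed.
End Hilbert.

(** * Bounded operators and their adjoints *)

Section Adjoints.
Variables (R : realType) (H : completeNormedModType (Cx R)).
Variable dot : {dot H for Num.conj}.
Local Notation C := (Cx R).
Hypothesis dot_norm : forall f, dot f f = `|f| ^+ 2.
Implicit Types (u v w h : H) (A B : H -> H).

Lemma bounded_operator_ge0 A : bounded_operator A ->
  exists2 M : C, 0 <= M & forall u, `|A u| <= M * `|u|.
Proof.
move=> [_ [c cA]]; exists `|c| => // u.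
have := cA u; have := le_trans (normr_ge0 _) (cA u).
by move/ger0_norm; rewrite normrM normr_id => ->.
Qed.

Lemma bounded_operator_id : bounded_operator (@id H).
Proof. by split=> //; exists 1 => u; rewrite mul1r. Qed.

Lemma bounded_operator_comp A B :
  bounded_operator A -> bounded_operator B -> bounded_operator (A \o B).
Proof.
move=> bA bB; have [M M0 MA] := bounded_operator_ge0 bA.
have [N N0 NB] := bounded_operator_ge0 bB.
split=> [c u v /=|]; first by rewrite bB.1 bA.1.
exists (M * N) => u /=; apply: le_trans (MA _) _.
by rewrite -mulrA ler_wpM2l.
Qed.

Lemma bounded_operator_iter k A : bounded_operator A -> bounded_operator (iter k A).
Proof.
move=> bA; elim: k => [|k ih]; first exact: bounded_operator_id.
exact: (bounded_operator_comp bA ih).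
Qed.

Lemma bounded_operator0 A : bounded_operator A -> A 0 = 0.
Proof.
move=> [lA _]; have := lA (-1) 0 0.
by rewrite scaler0 addr0 scaleN1r addNr.
Qed.

Lemma bounded_operatorZ A c u : bounded_operator A -> A (c *: u) = c *: A u.
Proof.
move=> bA; have := bA.1 c u 0.
by rewrite !addr0 (bounded_operator0 bA) addr0.
Qed.

Lemma bounded_operator_sum A (I : Type) (s : seq I) (F : I -> H) :
  bounded_operator A -> A (\sum_(i <- s) F i) = \sum_(i <- s) A (F i).
Proof.
move=> bA; elim: s => [|i s ih]; first by rewrite !big_nil bounded_operator0.
by rewrite !big_cons -ih; have := bA.1 1 (F i) (\sum_(j <- s) F j); rewrite !scale1r.
Qed.

Lemma bounded_operator_continuous A : bounded_operator A -> continuous A.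
Proof.
move=> bA u; have [M M0 MA] := bounded_operator_ge0 bA.
have M1 : 0 < M + 1 by rewrite ltr_wpDl.
apply/cvgrPdist_lt => e e0; apply/nbhs_ballP.
exists (e / (M + 1)); first exact: divr_gt0.
move=> v; rewrite -ball_normE /= ltr_pdivlMr// => uv.
have -> : A u - A v = A (u - v).
  by rewrite addrC -scaleN1r -bA.1 scaleN1r addrC.
apply: le_lt_trans (MA _) _; apply: le_lt_trans uv.
by rewrite mulrC ler_wpM2l// lerDl.
Qed.

Lemma riesz (L : H -> C) (M : C) : 0 <= M ->
  (forall c u v, L (c *: u + v) = c * L u + L v) ->
  (forall u, `|L u| <= M * `|u|) ->
  exists h, forall u, dot u h = L u.
Proof.
move=> M0 LD LM.
have L0 : L 0 = 0.
  by have := LM 0; rewrite normr0 mulr0 normr_le0 => /eqP.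
have [|c u x v y -> ->||h [_ _ hL]] :=
    @riesz_graph R H dot dot_norm (fun u x => x = L u) M M0.
- by rewrite L0.
- by rewrite LD.
- by move=> u x ->.
by exists h => u; apply: hL.
Qed.

Lemma adjoint_eq A v x : (forall u, dot (A u) v = dot u x) -> adjoint dot A v = x.
Proof.
move=> Ax; apply: (dot_extr dot_norm) => u.
have -> : dot u (adjoint dot A v) = dot (A u) v; last exact: Ax.
symmetry.
by apply: (xgetPex 0 (P := [set x | forall u, dot (A u) v = dot u x])); exists x.
Qed.

(** Riesz representation of [dot (A u) v] as a functional of [u] shows that [adjoint] never takes
    its default value here. *)
Lemma adjointP A u v : bounded_operator A -> dot (A u) v = dot u (adjoint dot A v).
Proof.
move=> bA; have [M M0 MA] := bounded_operator_ge0 bA.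
have [|c {}u w|{}u|h hA] := @riesz (fun u => dot (A u) v) (M * `|v|).
- by rewrite mulr_ge0.
- by rewrite bA.1 dotDl dotZl.
- apply: le_trans (CauchySchwarz_dot dot_norm _ _) _.
  by rewrite mulrAC ler_wpM2r.
by rewrite (adjoint_eq (x := h)).
Qed.

Lemma bounded_operator_adjoint A :
  bounded_operator A -> bounded_operator (adjoint dot A).
Proof.
move=> bA; split=> [c u v|].
  apply: adjoint_eq => w.
  by rewrite !dotDr !dotZr !adjointP.
have [M M0 MA] := bounded_operator_ge0 bA; exists M => v.
have [->|nz] := eqVneq (adjoint dot A v) 0; first by rewrite normr0 mulr_ge0.
have nz0 : 0 < `|adjoint dot A v| by rewrite normr_gt0.
(* With [x] the image of [v] under the adjoint, [|x|^2 = <A x, v> <= M |x| |v|], and [|x|]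
   cancels. *)
rewrite -(ler_pM2l nz0) -expr2 -dot_norm -adjointP//.
apply: le_trans (real_ler_norm _) _.
  by rewrite adjointP// dot_norm rpredX// normr_real.
apply: le_trans (CauchySchwarz_dot dot_norm _ _) _.
by rewrite mulrCA mulrA ler_wpM2r.
Qed.

(** * The hereditary calculus and its quadratic form *)

Section Calculus.
Variables (n : nat) (T : 'I_n -> H -> H).
Hypothesis bT : forall j, bounded_operator (T j).

Lemma bounded_operator_pow alpha : bounded_operator (op_pow T alpha).
Proof.
rewrite /op_pow; apply: big_ind => [||i _]; first exact: bounded_operator_id.
  by move=> A B; exact: bounded_operator_comp.
exact: bounded_operator_iter.
Qed.

Lemma op_pow_eigen alpha (lambda : 'I_n -> C) v :
  (forall i, T i v = lambda i *: v) ->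
  op_pow T alpha v = (\prod_(i < n) lambda i ^+ alpha i) *: v.
Proof.
move=> Tv; rewrite /op_pow.
apply: (big_rec2 (fun (A : H -> H) (c : C) => A v = c *: v)).
  by rewrite scale1r.
move=> i c A _ /= ->; rewrite bounded_operatorZ; last exact: bounded_operator_iter.
rewrite (mulrC (lambda i ^+ alpha i)) -scalerA; congr (_ *: _).
elim: (alpha i) => [|k ih]; first by rewrite scale1r.
by rewrite /= ih bounded_operatorZ// Tv scalerA exprSr.
Qed.

Lemma dot_hereditary_calculus (a : {mpoly C[n]}) u :
  dot (hereditary_calculus dot a T u) u =
  \sum_(alpha <- msupp a) a@_alpha * `|op_pow T alpha u| ^+ 2.
Proof.
rewrite dot_suml; apply: eq_bigr => alpha _; rewrite dotZl; congr (_ * _).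
rewrite [LHS]dot_conj -adjointP ?dot_norm; last exact: bounded_operator_pow.
by apply: conj_Creal; rewrite rpredX// normr_real.
Qed.

(** The quadratic form is a finite combination of squared norms of bounded images, hence continuous,
    and nonnegativity is a closed condition. *)
Lemma positive_hereditary_calculus (a : {mpoly C[n]}) (S : set H) :
  (forall u, closure S u) ->
  (forall u, S u -> 0 <= dot (hereditary_calculus dot a T u) u) ->
  positive_operator dot (hereditary_calculus dot a T).
Proof.
move=> dS S0 u.
pose Q v : C := \sum_(alpha <- msupp a) a@_alpha * `|op_pow T alpha v| ^+ 2.
have cQ : continuous Q.
  move=> v; apply: cvg_big => [|alpha _]; first exact: add_continuous.
  apply: cvgMr; rewrite expr2.
  under [in X in X @ _]eq_fun do rewrite expr2.
  have c : `|op_pow T alpha w|%R @[w --> v] --> (`|op_pow T alpha v|%R : C).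
    apply: cvg_norm; apply: bounded_operator_continuous.
    exact: bounded_operator_pow.
  exact: cvgM.
have clQ : closed (Q @^-1` [set x | 0 <= x]).
  by apply: preimage_closed (@closed_num_ge0 C) => v _; exact: cQ.
have : closure (Q @^-1` [set x | 0 <= x]) u.
  apply: closure_subset (dS u) => v /S0.
  by rewrite dot_hereditary_calculus.
by rewrite -(closure_id _).1// dot_hereditary_calculus.
Qed.
End Calculus.
End Adjoints.

(** * Reproducing kernels and multipliers *)

Section ReproducingKernel.
Variables (R : realType) (n : nat) (H : completeNormedModType (Cx R)).
Variable dot : {dot H for Num.conj}.
Local Notation C := (Cx R).
Variables (ev : H -> 'rV[C]_n -> C) (D : set 'rV[C]_n).
Variable K : 'rV[C]_n -> 'rV[C]_n -> C.
Hypothesis rkhsH : is_rkhs dot ev D K.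
Let dot_norm := rkhs_norm rkhsH.

Lemma kernel_functions : exists k : 'rV[C]_n -> H,
  (forall w f, D w -> ev f w = dot f (k w)) /\
  (forall z w, D z -> D w -> dot (k w) (k z) = K z w).
Proof.
have /choice[k kP] : forall w, exists k : H, D w ->
    (forall z, D z -> ev k z = K z w) /\ (forall f, ev f w = dot f k).
  move=> w; have [Dw|nDw] := pselect (D w); last by exists 0.
  by have [k k1 k2] := rkhs_reproducing rkhsH Dw; exists k.
exists k; split=> [w f /kP[] //|z w Dz Dw].
by rewrite -(kP z Dz).2 (kP w Dw).1.
Qed.

Section KernelSpan.
Variable k : 'rV[C]_n -> H.
Hypothesis evE : forall w f, D w -> ev f w = dot f (k w).
Hypothesis dotk : forall z w, D z -> D w -> dot (k w) (k z) = K z w.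

Definition kernel_span : set H := [set u | exists2 s : seq (C * 'rV[C]_n),
  {in s, forall p, D p.2} & u = \sum_(p <- s) p.1 *: k p.2].

(** The projection [h] of [u] onto the closed span has the same products with all kernel functions,
    hence the same values on [D], so [u = h]. *)
Lemma kernel_span_dense u : closure kernel_span u.
Proof.
have [||c {}v x w y [[s Ds ->] ->] [[t Dt ->] ->]|v x [_ ->]|h [clh _ hP]] :=
    @riesz_graph R H dot dot_norm
      (fun v x => kernel_span v /\ x = dot v u) `|u|.
- by rewrite normr_ge0.
- by rewrite dot0l; split=> //; exists [::]; rewrite ?big_nil.
- rewrite dotDl dotZl; split=> //.
  exists ([seq (c * p.1, p.2) | p <- s] ++ t).
    by move=> p; rewrite mem_cat => /orP[/mapP[q qs ->]|/Dt//]; exact: Ds qs.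
  rewrite big_cat big_map/= scaler_sumr; congr (_ + _).
  by apply: eq_bigr => p _; rewrite scalerA.
- by rewrite mulrC (CauchySchwarz_dot dot_norm).
have -> : u = h; last by apply: closure_subset clh => v [x []].
apply: (rkhs_inj rkhsH) => z Dz; rewrite !evE// ![dot _ (k z)]dot_conj; congr (_^*).
symmetry; apply: hP; split=> //; exists [:: (1, z)].
  by move=> p; rewrite inE => /eqP ->.
by rewrite big_seq1 scale1r.
Qed.

Lemma dot_kernel_span (s : seq (C * 'rV[C]_n)) (a : C * 'rV[C]_n -> C) :
  {in s, forall p, D p.2} ->
  dot (\sum_(p <- s) a p *: k p.2) (\sum_(p <- s) a p *: k p.2) =
  \sum_(p <- s) \sum_(q <- s) a p * (a q)^* * K q.2 p.2.
Proof.
move=> Ds; rewrite dot_suml; apply: eq_big_seq => p ps.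
rewrite dot_sumr; apply: eq_big_seq => q qs.
by rewrite dotZl dotZr (dotk (Ds q qs) (Ds p ps)) mulrA.
Qed.

(** * Multipliers from a positivity condition *)

Section Multiplier.
Variables (g : 'rV[C]_n -> C) (c : C).
Hypothesis c_gt0 : 0 < c.
Hypothesis psd_g : psd D (fun z w => (1 - c * (g z * (g w)^*)) * K z w).

Let M := sqrtC c^-1.

Let M_ge0 : 0 <= M. Proof. by rewrite sqrtC_ge0 invr_ge0 ltW. Qed.

(** The hypothesis on [s] reads [|u|^2 - c |u'|^2 >= 0] for the two combinations [u] and [u'],
    whence the constant [M], the square root of [1 / c]. *)
Lemma kernel_multiplier_le (s : seq (C * 'rV[C]_n)) : {in s, forall p, D p.2} ->
  `|\sum_(p <- s) (p.1 * (g p.2)^*) *: k p.2| <=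
  M * `|\sum_(p <- s) p.1 *: k p.2|.
Proof.
move=> Ds; have := psd_g Ds.
rewrite (_ : \sum_(p <- s) _ = `|\sum_(p <- s) p.1 *: k p.2| ^+ 2 -
     c * `|\sum_(p <- s) (p.1 * (g p.2)^*) *: k p.2| ^+ 2); last first.
  rewrite -!dot_norm (dot_kernel_span (fun p => p.1 * (g p.2)^*))//.
  rewrite (dot_kernel_span fst)// mulr_sumr -sumrB; apply: eq_bigr => p _.
  rewrite mulr_sumr -sumrB; apply: eq_bigr => q _.
  by rewrite rmorphM/= conjCK; ring.
rewrite subr_ge0 -ler_pdivlMl// => le.
by rewrite -(@ler_pXn2r _ 2) ?nnegrE ?mulr_ge0// exprMn sqrtCK.
Qed.

Lemma multiplier_exists f : exists2 h : H, `|h| <= M * `|f| &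
  forall w, D w -> ev h w = g w * ev f w.
Proof.
(* With [A] sending [k w] to [conj(g w) k w], this is the graph of [<A u, f>] on the span, so [h]
   plays the part of the adjoint of [A] at [f]. A relation is used because [u] may have several
   representations [s]. *)
pose G u x := exists s : seq (C * 'rV[C]_n), [/\ {in s, forall p, D p.2},
  u = \sum_(p <- s) p.1 *: k p.2 &
  x = dot (\sum_(p <- s) (p.1 * (g p.2)^*) *: k p.2) f].
have [||b v x w y [s [Ds -> ->]] [t [Dt -> ->]]|v x [s [Ds -> ->]]|h [_ hf hP]] :=
    @riesz_graph R H dot dot_norm G (M * `|f|).
- by rewrite mulr_ge0.
- by exists [::]; rewrite !big_nil dot0l.
- exists ([seq (b * p.1, p.2) | p <- s] ++ t); split.
  + by move=> p; rewrite mem_cat => /orP[/mapP[q qs ->]|/Dt//]; exact: Ds qs.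
  + rewrite big_cat big_map/= scaler_sumr; congr (_ + _).
    by apply: eq_bigr => p _; rewrite scalerA.
  + rewrite big_cat big_map/= dotDl -dotZl scaler_sumr; congr (dot _ f + _).
    by apply: eq_bigr => p _; rewrite scalerA mulrA.
- apply: le_trans (CauchySchwarz_dot dot_norm _ _) _.
  by rewrite mulrAC ler_wpM2r// kernel_multiplier_le.
exists h => // w Dw; rewrite !evE// ![dot _ (k w)]dot_conj.
rewrite (hP _ ((g w)^* * dot (k w) f)) ?rmorphM/= ?conjCK//.
exists [:: (1, w)]; rewrite !big_seq1/= scale1r mul1r dotZl; split=> //.
by move=> p; rewrite inE => /eqP ->.
Qed.

Local Notation Mg := (mult_op ev D g).

Lemma mult_opP f w : D w -> ev (Mg f) w = g w * ev f w.
Proof.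
move: w; apply: (xgetPex 0 (P := [set h | forall z, D z -> ev h z = g z * ev f z])).
by have [h _ hP] := multiplier_exists f; exists h.
Qed.

Lemma bounded_mult_op : bounded_operator Mg.
Proof.
split=> [b u v|].
  apply: (rkhs_inj rkhsH) => z Dz.
  by rewrite (rkhs_linear rkhsH)// !mult_opP// (rkhs_linear rkhsH)//; ring.
exists M => f; have [h hf hP] := multiplier_exists f.
by rewrite (_ : Mg f = h)//; apply: (rkhs_inj rkhsH) => z Dz; rewrite mult_opP// hP.
Qed.

Lemma adjoint_mult_op_kernel w : D w -> adjoint dot Mg (k w) = (g w)^* *: k w.
Proof.
move=> Dw; apply: (adjoint_eq dot_norm) => u.
by rewrite dotZr conjCK -!evE// mult_opP.
Qed.
End Multiplier.
End KernelSpan.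
End ReproducingKernel.

Theorem proposition5p9 (R : realType) (n : nat) (n_ge2 : (2 <= n)%N)
  (P : 'I_n -> {mpoly (Cx R)[n]}) (posregP : positive_regular P)
  (m : 'I_n -> nat) (m_gt0 : forall j, (0 < m j)%N)
  (hered : hereditary_polynomial (triangle P)
             (fun z w => (triangle_kernel P m z w)^-1))
  (H : completeNormedModType (Cx R)) (dot : {dot H for Num.conj})
  (ev : H -> 'rV[Cx R]_n -> Cx R)
  (rkhsH : is_rkhs dot ev (triangle P) (triangle_kernel P m)) :
  triangle_contraction dot P m
    (fun j => adjoint dot (mult_op ev (triangle P) (fun z => z 0 j))).
Proof.
have [k [evE dotk]] := kernel_functions rkhsH.
have dot_norm := rkhs_norm rkhsH.
have mult j : exists2 c : Cx R, 0 < c & psd (triangle P)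
    (fun z w => (1 - c * (z 0 j * (w 0 j)^*)) * triangle_kernel P m z w).
  have [c c0 /sos_limit_psd hc] := sos_limit_contraction posregP m_gt0 j.
  by exists c.
pose M j := mult_op ev (triangle P) (fun z => z 0 j).
have MP j f w : triangle P w -> ev (M j f) w = w 0 j * ev f w.
  by have [c c0 hc] := mult j; exact: (mult_opP rkhsH evE dotk c0 hc).
have bM j : bounded_operator (M j).
  by have [c c0 hc] := mult j; exact: (bounded_mult_op rkhsH evE dotk c0 hc).
have bT j : bounded_operator (adjoint dot (M j)).
  exact: bounded_operator_adjoint.
have eigen j w : triangle P w -> adjoint dot (M j) (k w) = (w 0 j)^* *: k w.
  by have [c c0 hc] := mult j; exact: (adjoint_mult_op_kernel rkhsH evE dotk c0 hc).
split=> //.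
  (* Commutation is transferred from the multiplication operators, where it holds pointwise on
     [D]. *)
  move=> i j u; apply: (dot_extr dot_norm) => v.
  rewrite -!(adjointP dot_norm _ _ (bM _)); congr (dot _ u).
  by apply: (rkhs_inj rkhsH) => z Dz; rewrite !MP// mulrCA.
have [a aE] : exists a, hereditary_expansion (triangle P)
    (fun z w => (triangle_kernel P m z w)^-1) a.
  apply: hereditary_polynomial_expansion hered; first exact: triangle_rotate.
  by move=> c z w c1; rewrite triangle_kernel_rotate.
exists a => //.
apply: (positive_hereditary_calculus dot_norm bT (S := kernel_span (triangle P) k)).
  exact: (kernel_span_dense rkhsH evE).
move=> u [s Ds ->]; rewrite (dot_hereditary_calculus dot_norm bT).
(* Kernel functions are joint eigenvectors, so powers act on the coefficients alone. *)
have powE alpha : op_pow (fun j => adjoint dot (M j)) alpha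
    (\sum_(p <- s) p.1 *: k p.2) =
    \sum_(p <- s) (p.1 * \prod_(i < n) (p.2 0 i)^* ^+ alpha i) *: k p.2.
  have bp := bounded_operator_pow bT alpha.
  rewrite (bounded_operator_sum _ _ bp); apply: eq_big_seq => p ps.
  rewrite (bounded_operatorZ _ _ bp).
  rewrite (op_pow_eigen bT _ (lambda := fun i => (p.2 0 i)^*)).
    by rewrite scalerA.
  by move=> i; apply: eigen; exact: Ds.
rewrite (_ : \sum_(_ <- _) _ = `|\sum_(p <- s) p.1| ^+ 2) ?exprn_ge0//.
(* The target [|\sum p.1|^2] is written with the factor [K^-1 * K = 1] in each term, to be matched
   with the expansion [a] of [K^-1] at [z = q.2], [w = p.2]. *)
transitivity (\sum_(p <- s) \sum_(q <- s) p.1 * q.1^* *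
   ((triangle_kernel P m q.2 p.2)^-1 * triangle_kernel P m q.2 p.2)); last first.
  rewrite normCK rmorph_sum/= mulr_suml; apply: eq_big_seq => p ps.
  rewrite mulr_sumr; apply: eq_big_seq => q qs.
  have nz := triangle_kernel_neq0 posregP m (Ds q qs) (Ds p ps).
  by rewrite mulVf// mulr1.
under eq_bigr => alpha _.
  rewrite powE -dot_norm.
  rewrite (dot_kernel_span dotk
    (fun p => p.1 * \prod_(i < n) (p.2 0 i)^* ^+ alpha i) Ds) mulr_sumr.
  under eq_bigr do rewrite mulr_sumr.
  over.
rewrite exchange_big/=; apply: eq_big_seq => p ps.
rewrite exchange_big/=; apply: eq_big_seq => q qs.
rewrite (aE _ _ (Ds q qs) (Ds p ps)) mulr_suml mulr_sumr; apply: eq_bigr => alpha _.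
have -> : (q.1 * \prod_(i < n) (q.2 0 i)^* ^+ alpha i)^* =
    q.1^* * \prod_(i < n) q.2 0 i ^+ alpha i.
  rewrite rmorphM rmorph_prod/=; congr (_ * _).
  by apply: eq_bigr => i _; rewrite rmorphXn/= conjCK.
by ring.
Qed.
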